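(* Let $F$ be the distribution function of a random variable $X>0$ with continuous distribution, let $k\ge 1$ be an integer and $a>1$ a real number, and let $N$ have the Harris($a,k$) law, with probability generating function $Q(s)=s/[a-(a-1)s^k]^{1/k}$. For $c\in(0,1)$, $F$ is $N$-min stable with constant $c$ if and only if $F$ is generalized semi-Pareto($p,\alpha,\beta$) with $p=1/a=c^\alpha$ and $\beta=1/k$ (i.e. $p=1/a$, $\beta=1/k$, and $\alpha>0$ is determined by $c^\alpha=1/a$). In particular, $F$ is $N$-min stable with some constant $c\in(0,1)$ if and only if $F$ is generalized semi-Pareto($1/a,\alpha,1/k$) for some $\alpha>0$.
   Context: For a random variable $X>0$ with continuous distribution function $F$, put $R(x)=1-F(x)$. For a $\{1,2,\ldots\}$-valued random variable $N$ independent of $X$ with probability generating function $Q(s)=E[s^N]$, $F$ is called $N$-min stable with constant $c\in(0,1)$ if $Q[R(cx)]=R(x)$ for all $x>0$. A continuous distribution function $F$ on $(0,\infty)$ is generalized semi-Pareto($p,\alpha,\beta$), with $0<p<1$, $\alpha>0$, $\beta>0$, if $F(x)=1-[1+\psi(x)]^{-\beta}$ for all $x>0$, where $\psi:(0,\infty)\to[0,\infty)$ satisfies $\psi(x)=\psi(p^{1/\alpha}x)/p$ for all $x>0$. *)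

(* Defs.v *)
From HB Require Import structures.
From mathcomp Require Export all_boot all_order all_algebra.
From mathcomp Require Export all_classical all_reals all_analysis.
Export Order.TTheory GRing.Theory Num.Theory.
Export numFieldNormedType.Exports.

Set Implicit Arguments.
Unset Strict Implicit.
Unset Printing Implicit Defensive.

Local Open Scope classical_set_scope.
Local Open Scope ring_scope.

Definition independent_RV d d1 d2 (T : measurableType d)
    (T1 : measurableType d1) (T2 : measurableType d2) (R : realType)
    (P : probability T R) (X : {RV P >-> T1}) (Y : {RV P >-> T2}) : Prop :=
  forall (A : set T1) (B : set T2), measurable A -> measurable B ->
    P (X @^-1` A `&` Y @^-1` B) = (P (X @^-1` A) * P (Y @^-1` B))%E.

(* Probability generating function, with 0 ^+ 0 = 1. *)
Definition pgf d (T : measurableType d) (R : realType) (P : probability T R)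
    (N : {RV P >-> nat}) (s : R) : \bar R :=
  ('E_P[(fun w => (s ^+ N w)%R)])%E.

Definition harris_pgf (R : realType) (a : R) (k : nat) (s : R) : R :=
  s / (a - (a - 1) * s ^+ k) `^ (k%:R^-1).

(* A law on the positive integers is determined by its generating function
   on [0, 1]. *)
Definition harris_law d (T : measurableType d) (R : realType)
    (P : probability T R) (N : {RV P >-> nat}) (a : R) (k : nat) : Prop :=
  {ae P, forall w, (0 < N w)%N} /\
  forall s : R, 0 <= s <= 1 -> pgf N s = (harris_pgf a k s)%:E.

Definition survival (R : realType) (F : R -> R) (x : R) : R := 1 - F x.

Definition min_stable d (T : measurableType d) (R : realType)
    (P : probability T R) (N : {RV P >-> nat}) (F : R -> R) (c : R) : Prop :=
  0 < c < 1 /\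
  forall x : R, 0 < x -> pgf N (survival F (c * x)) = (survival F x)%:E.

(* To be applied to a continuous distribution function F of a positive random
   variable. Only the values of psi on (0, +oo) matter. *)
Definition generalized_semi_pareto (R : realType) (F : R -> R)
    (p alpha beta : R) : Prop :=
  [/\ 0 < p < 1, 0 < alpha, 0 < beta &
    exists psi : R -> R,
      [/\ forall x, 0 < x -> 0 <= psi x,
          forall x, 0 < x -> psi x = psi (p `^ (alpha^-1) * x) / p &
          forall x, 0 < x -> F x = 1 - (1 + psi x) `^ (- beta)]].

(* Main.v *)
Require Import Defs.
From mathcomp Require Import ring lra.

Set Implicit Arguments.
Unset Strict Implicit.
Unset Printing Implicit Defensive.

(** Writing a survival function as [(1 + psi) ^ (- 1 / k)] turns the Harris
    generating function into multiplication by [a]: it maps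
    [(1 + u) ^ (- 1 / k)] to [(1 + a u) ^ (- 1 / k)].  Hence min-stability with
    constant [c] is the equation [psi x = a psi (c x)].  The substitution needs
    the survival function to vanish nowhere: if it vanished at [x] it would
    vanish at every [c ^ n x], contradicting its continuity at [0], where it is
    [1]. *)

Local Open Scope classical_set_scope.
Local Open Scope ring_scope.

Lemma powRK (R : realType) (x r : R) : 0 <= x -> r != 0 ->
  (x `^ r) `^ r^-1 = x.
Proof. by move=> x0 r0; rewrite -powRrM mulfV// powRr1. Qed.

Lemma powR_eqP (R : realType) (c y alpha : R) : 0 < c < 1 -> 0 < y ->
  (c `^ alpha = y) <-> (alpha = ln y / ln c).
Proof.
move=> /[dup] c01 /andP[c0 _] y0.
have lnc : ln c != 0 by rewrite lt_eqF// ln_lt0.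
split=> [<-|->]; first by rewrite ln_powR mulfK.
by rewrite /powR gt_eqF// divfK// lnK.
Qed.

(** Taking logarithms forces [alpha = ln a^-1 / ln c], a quotient of two negative numbers. *)
Lemma exists_unique_exponent (R : realType) (a c : R) : 1 < a -> 0 < c < 1 ->
  exists! alpha : R, 0 < alpha /\ c `^ alpha = a^-1.
Proof.
move=> a1 c01; have a0 : 0 < a by lra.
have iff_alpha alpha := @powR_eqP R c a^-1 alpha c01 ltac:(by rewrite invr_gt0).
exists (ln a^-1 / ln c); split=> [|beta [_ /iff_alpha ->//]].
split; last exact/iff_alpha.
rewrite nmulr_lgt0 ?invr_lt0 ?ln_lt0// invr_gt0 a0/=.
by rewrite invf_lt1.
Qed.

Section harris.
Variables (R : realType) (a : R) (k : nat).
Hypotheses (k_gt0 : (0 < k)%N) (a_gt1 : 1 < a).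

Let k_neq0 : k%:R != 0 :> R.
Proof. by rewrite pnatr_eq0 -lt0n. Qed.

Let a_gt0 : 0 < a.
Proof. exact: lt_trans a_gt1. Qed.

(** The [k]-th power of the argument is [(1 + u)^-1], so the base in the denominator becomes
    [(1 + a * u) / (1 + u)], whose factor [1 + u] cancels against the numerator. *)
Lemma harris_pgf_powR (u : R) : 0 <= u ->
  harris_pgf a k ((1 + u) `^ (- k%:R^-1)) = (1 + a * u) `^ (- k%:R^-1).
Proof.
move=> u0; have u1 : 0 < 1 + u by lra.
have au0 : 0 < 1 + a * u by rewrite ltr_pwDl// mulr_ge0// ltW// a_gt0.
rewrite /harris_pgf -powR_mulrn ?powR_ge0// -powRrM mulNr mulVf//.
rewrite powR_inv1; last exact: ltW.
have den : a - (a - 1) * (1 + u)^-1 = (1 + a * u) / (1 + u).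
  by field; exact: lt0r_neq0.
rewrite den !powRN -invfM -powRM; [|exact: ltW|by rewrite divr_ge0// ltW].
by rewrite mulrC divfK// gt_eqF.
Qed.

(** Since [s ^+ k <= 1], the base in the denominator is at least 1. This is what carries a zero of
    [G] from [x] to [c * x]. *)
Lemma harris_pgf_eq0 (s : R) : 0 <= s <= 1 ->
  (harris_pgf a k s == 0) = (s == 0).
Proof.
move=> /andP[s0 s1]; rewrite mulf_eq0 invr_eq0 powR_eq0.
have sk1 : s ^+ k <= 1 by rewrite exprn_ile1.
have den : 0 < a - (a - 1) * s ^+ k.
  by move: (s ^+ k) sk1 (a_gt1) => t t1 a1; nra.
by rewrite (gt_eqF den) orbF.
Qed.

Variables (G : R -> R) (c : R).
Hypotheses (G01 : forall x, 0 <= G x <= 1) (c01 : 0 < c < 1).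

Lemma harris_fixed_neq0 :
  (forall x : R, 0 < x -> harris_pgf a k (G (c * x)) = G x) ->
  {for 0, continuous G} -> G 0 != 0 -> forall x, 0 < x -> G x != 0.
Proof.
move=> GE Gcont G0 x x0; apply: contraNneq G0 => Gx.
have Gcx n : G (x * c ^+ n) = 0.
  elim: n => [|n IH]; first by rewrite mulr1.
  apply/eqP; rewrite -harris_pgf_eq0// exprSr mulrA mulrC GE ?IH//.
  by rewrite mulr_gt0// exprn_gt0//; case/andP: c01.
have cn0 : (x * c ^+ n) @[n --> \oo] --> 0.
  by apply: cvg_geometric; case/andP: c01 => c0 c1; rewrite gtr0_norm.
have GcxG0 : G (x * c ^+ n) @[n --> \oo] --> G 0.
  exact: (cvg_comp _ _ cn0 Gcont).
have Gcx0 : G (x * c ^+ n) @[n --> \oo] --> 0.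
  by under eq_cvg do rewrite Gcx; exact: cvg_cst.
by apply/eqP/(cvg_unique _ GcxG0 Gcx0); exact: norm_hausdorff.
Qed.

Lemma harris_fixedP : {for 0, continuous G} -> G 0 != 0 ->
  (forall x : R, 0 < x -> harris_pgf a k (G (c * x)) = G x) <->
  exists psi : R -> R,
    [/\ forall x, 0 < x -> 0 <= psi x,
        forall x, 0 < x -> psi x = psi (c * x) * a &
        forall x, 0 < x -> G x = (1 + psi x) `^ (- k%:R^-1)].
Proof.
move=> Gcont G0; have [c0 _] := andP c01.
split=> [GE|[psi [psi0 psiE GE]] x x0]; last first.
  have cx0 : 0 < c * x by exact: mulr_gt0.
  by rewrite !GE// harris_pgf_powR ?psi0// (psiE x)// mulrC.
have Gpos x : 0 < x -> 0 < G x.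
  move=> x0; rewrite lt0r (harris_fixed_neq0 GE Gcont G0 x0)/=.
  by case/andP: (G01 x).
(* Solves [G = (1 + psi) ^ (- 1 / k)] for [psi], which is possible because [G] is positive; [psi] is
   nonnegative because [G <= 1]. *)
pose psi x := G x `^ (- k%:R) - 1.
have psi0 x : 0 < x -> 0 <= psi x.
  move=> x0; rewrite subr_ge0 powRN -powR_inv1 ?powR_ge0// -powRrM mulrN1.
  rewrite powRN powR_mulrn ?(ltW (Gpos _ x0))//.
  rewrite invf_ge1 ?exprn_gt0 ?Gpos// exprn_ile1//; by case/andP: (G01 x).
have GpsiE x : 0 < x -> G x = (1 + psi x) `^ (- k%:R^-1).
  move=> x0; rewrite /psi addrC subrK -invrN powRK ?oppr_eq0//.
  by rewrite ltW// Gpos.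
exists psi; split=> // x x0.
have cx0 : 0 < c * x by exact: mulr_gt0.
have acx0 : 0 <= a * psi (c * x) by rewrite mulr_ge0 ?psi0// ltW// a_gt0.
(* The fixed-point equation reads [G x = (1 + a * psi (c * x)) ^ (- 1 / k)]; raising it to the power
   [- k] leaves [psi x = a * psi (c * x)]. *)
rewrite {1}/psi -(GE _ x0) (GpsiE _ cx0) harris_pgf_powR ?psi0//.
rewrite -invrN -{2}[- k%:R]invrK powRK ?invr_eq0 ?oppr_eq0//.
  by rewrite addrC addKr mulrC.
by rewrite addr_ge0.
Qed.

End harris.

Lemma survival_itv d (T : measurableType d) (R : realType)
    (P : probability T R) (X : {RV P >-> R}) (F : R -> R) :
  (forall x, cdf X x = (F x)%:E) -> forall x, 0 <= survival F x <= 1.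
Proof.
move=> cdfE x; have := cdf_ge0 X x; have := cdf_le1 X x.
by rewrite cdfE !lee_fin /survival => ? ?; apply/andP; split; lra.
Qed.

(** The event [X <= 0] lies in a null set, so [F 0 = 0]. *)
Lemma survival_at0 d (T : measurableType d) (R : realType)
    (P : probability T R) (X : {RV P >-> R}) (F : R -> R) :
  {ae P, forall w, 0 < X w} -> cdf X 0 = (F 0)%:E -> survival F 0 = 1.
Proof.
move=> [A [mA PA sub]] cdfE; rewrite /survival.
suff F0 : (F 0)%:E = 0%E by case: F0 => ->; rewrite subr0.
apply/eqP; rewrite -cdfE eq_le cdf_ge0 andbT -PA.
apply: (@le_measure _ _ _ P (X @^-1` `]-oo, 0]) A); rewrite ?inE//.
  by rewrite -[X in measurable X]setTI; exact: measurable_funPT.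
move=> w /=; rewrite in_itv/= => Xw; apply: sub => /=.
by apply/negP; rewrite -leNgt.
Qed.

(** The Harris law prescribes the generating function on [0, 1] only, and survival values stay
    there. *)
Lemma min_stable_harrisP d (T : measurableType d) (R : realType)
    (P : probability T R) (N : {RV P >-> nat}) (F : R -> R) (a c : R)
    (k : nat) :
  harris_law N a k -> (forall x, 0 <= survival F x <= 1) -> 0 < c < 1 ->
  min_stable N F c <->
  forall x : R, 0 < x -> harris_pgf a k (survival F (c * x)) = survival F x.
Proof.
move=> [_ pgfE] S01 c01; split=> [[_ st] x x0|st].
  by have := st _ x0; rewrite pgfE// => -[].
by split=> // x x0; rewrite pgfE// st.
Qed.

Theorem mainTheorem3 (R : realType) (d : measure_display)
  (T : measurableType d) (P : probability T R)
  (X : {RV P >-> R}) (N : {RV P >-> nat}) (F : R -> R) (a : R) (k : nat)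
  (X_gt0 : {ae P, forall w, 0 < X w})
  (F_cdf : forall x : R, cdf X x = (F x)%:E)
  (F_cont : continuous F)
  (k_ge1 : (1 <= k)%N) (a_gt1 : 1 < a)
  (N_harris : harris_law N a k)
  (XN_indep : independent_RV X N) :
  (forall c : R, 0 < c < 1 ->
     (exists! alpha : R, 0 < alpha /\ c `^ alpha = a^-1) /\
     (min_stable N F c <->
      exists alpha : R, [/\ 0 < alpha, c `^ alpha = a^-1 &
        generalized_semi_pareto F a^-1 alpha k%:R^-1])) /\
  ((exists c : R, 0 < c < 1 /\ min_stable N F c) <->
   (exists alpha : R, 0 < alpha /\
      generalized_semi_pareto F a^-1 alpha k%:R^-1)).
Proof.
have a0 : 0 < a by lra.
have a01 : 0 < a^-1 < 1 by rewrite invr_gt0 a0 invf_lt1.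
have S01 := survival_itv F_cdf.
have S0 : survival F 0 != 0 by rewrite (survival_at0 X_gt0)// oner_eq0.
have Scont : {for 0, continuous (survival F)}.
  by apply: cvgB; [exact: cvg_cst|exact: F_cont].
have stableP c : 0 < c < 1 -> min_stable N F c <->
    exists alpha : R, [/\ 0 < alpha, c `^ alpha = a^-1 &
      generalized_semi_pareto F a^-1 alpha k%:R^-1].
  move=> c01; have [c0 _] := andP c01.
  apply: (iff_trans (min_stable_harrisP N_harris S01 c01)).
  apply: (iff_trans (harris_fixedP k_ge1 a_gt1 S01 c01 Scont S0)).
  split=> [[psi [psi0 psiE SE]]|[alpha [alpha0 cE [_ _ _ [psi [psi0 psiE FE]]]]]].
    have [alpha [[alpha0 cE] _]] := exists_unique_exponent a_gt1 c01.
    exists alpha; split=> //; split=> //.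
      by rewrite invr_gt0 ltr0n.
    exists psi; split=> // x x0.
      (* With [p = a^-1 = c ^ alpha], the scale [p ^ (1 / alpha)] is [c] and division by [p] is
         multiplication by [a], so the same [psi] serves both equations. *)
      by rewrite -cE powRK ?gt_eqF ?ltW// cE invrK psiE.
    by rewrite -SE// /survival subKr.
  exists psi; split=> // x x0.
    by rewrite psiE// -{1}cE powRK ?gt_eqF ?ltW// invrK.
  by rewrite /survival FE// subKr.
split=> [c c01|].
  by split; [exact: exists_unique_exponent|exact: stableP].
split=> [[c [c01 /(stableP _ c01)[alpha [alpha0 _ pareto]]]]|].
  by exists alpha.
(* This [c] solves [c ^ alpha = a^-1]; it is below 1 because [a^-1] is and a positive power is
   increasing. *)
move=> [alpha [alpha0 pareto]]; exists (a^-1 `^ alpha^-1).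
have c01 : 0 < a^-1 `^ alpha^-1 < 1.
  have [ai0 ai1] := andP a01; rewrite powR_gt0//=.
  have <- : 1 `^ alpha^-1 = 1 :> R by rewrite powR1.
  rewrite gt0_ltr_powR ?invr_gt0// nnegrE//.
  exact: ltW.
split=> //; apply/(stableP _ c01); exists alpha; split=> //.
rewrite -{2}[alpha]invrK powRK ?invr_eq0 ?gt_eqF//.
by rewrite ltW//; case/andP: a01.
Qed.
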